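(* Let $k \in \mathbb{Z}$ and $n,m,j\in\mathbb{Z}^+$ with $n\geq 2$, $k\not\equiv 0 \pmod n$, $m\geq 3$, and $1\leq j < \frac{m}{2}$, and let $G(m,j)$ be the generalized Petersen graph. Then: (1) if $(3,n)\mid k$, then $\chi_{(n,k)}(G(m,j)) = \chi(G(m,j))$; (2) if $(3,n) \nmid km$, then $\chi_{(n,k)}(G(m,j))$ does not exist; (3) if $(3,n)\nmid k$, $(3,n) \mid km$, and $3 \nmid j$, then $\chi_{(n,k)}(G(m,j))$ exists and $\chi(G(m,j)) \leq \chi_{(n,k)}(G(m,j)) \leq 2 \chi(G(m,j))$.
   Context: $G(m,j)$ has vertex set $\{v_i,u_i : 0\le i<m\}$ and edges $v_iv_{i+1}$, $v_iu_i$, $u_iu_{i+j}$ for $0\le i<m$, indices mod $m$. $(a,b)$ denotes the greatest common divisor. For a graph $G=(V,E)$, a $\mathbb{Z}$-labeling is a map $\ell:V\to\mathbb{Z}$; its order is the size of its range; it is proper if adjacent vertices get different labels; $\chi(G)$ is the minimum order of a proper labeling. $N(v)$ is the open neighborhood of $v$. An open coloring with remainder $k \bmod n$ is a labeling with $\sum_{w\in N(v)}\ell(w)\equiv k \pmod n$ for all $v\in V$. If no proper such coloring exists, $\chi_{(n,k)}(G)$ does not exist; otherwise it is the minimum order of a proper open coloring with remainder $k\bmod n$. *)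

(* Defs.v *)
From mathcomp Require Import all_boot all_order all_algebra.
From mathcomp Require Import boolp.

Set Implicit Arguments.
Unset Strict Implicit.
Unset Printing Implicit Defensive.

Import Order.TTheory GRing.Theory Num.Theory.
Local Open Scope ring_scope.

Record sgraph := SGraph {
  vertex :> finType;
  adj : rel vertex;
  adj_sym : symmetric adj;
  adj_irrefl : irreflexive adj }.

Definition nbhd (G : sgraph) (v : G) : {set G} := [set w | adj v w].

Definition label_order (G : sgraph) (l : G -> int) : nat := size (undup (codom l)).

Definition proper_labeling (G : sgraph) (l : G -> int) : Prop :=
  forall x y : G, adj x y -> l x <> l y.

Definition open_coloring (n : nat) (k : int) (G : sgraph) (l : G -> int) : Prop :=
  forall v : G, (\sum_(w in nbhd v) l w = k %[mod n%:Z])%Z.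

Definition attained (G : sgraph) (P : (G -> int) -> Prop) : pred nat :=
  fun d => `[< exists2 l, P l & label_order l = d >].

Lemma proper_attained (G : sgraph) : exists d, attained (@proper_labeling G) d.
Proof.
pose l (x : G) : int := (enum_rank x)%:Z.
exists (label_order l); apply/asboolP; exists l => // x y xy [/ord_inj/enum_rank_inj exy].
by rewrite exy adj_irrefl in xy.
Qed.

Definition chi (G : sgraph) : nat := ex_minn (proper_attained G).

(* [None] encodes "does not exist". *)
Definition chi_open (n : nat) (k : int) (G : sgraph) : option nat :=
  if pselect (exists d, attained (fun l : G -> int => proper_labeling l /\ open_coloring n k l) d)
    is left h then Some (ex_minn h) else None.

(* [inl i] is the vertex v_i and [inr i] is the vertex u_i. *)
Definition petersen_arc (m j : nat) : rel ('I_m + 'I_m) := fun x y =>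
  match x, y with
  | inl a, inl b => b == (a + 1) %% m :> nat
  | inl a, inr b => a == b
  | inr a, inr b => b == (a + j) %% m :> nat
  | inr _, inl _ => false
  end%N.

Definition petersen_adj (m j : nat) : rel ('I_m + 'I_m) := fun x y =>
  petersen_arc j x y || petersen_arc j y x.

Lemma petersen_adj_sym (m j : nat) : symmetric (@petersen_adj m j).
Proof. by move=> x y; rewrite /petersen_adj orbC. Qed.

Lemma shift_neq (m s : nat) (a : 'I_m) :
  (0 < s < m)%N -> (nat_of_ord a == (a + s) %% m)%N = false.
Proof.
move=> /andP[s0 sm]; apply/negbTE/negP => /eqP e.
have : (a + 0 == a + s %[mod m])%N by rewrite addn0 -e modn_small.
by rewrite eqn_modDl mod0n modn_small // eq_sym eqn0Ngt s0.
Qed.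

Lemma petersen_adj_irrefl (m j : nat) :
  (0 < j)%N -> (j.*2 < m)%N -> irreflexive (@petersen_adj m j).
Proof.
move=> j0 jm; have ltjm : (j < m)%N by apply: leq_ltn_trans jm; rewrite -addnn leq_addr.
by case=> a; rewrite /petersen_adj /= orbb shift_neq //= ?j0 //; apply: leq_ltn_trans ltjm.
Qed.

Definition petersen (m j : nat) (hj : (0 < j)%N) (hjm : (j.*2 < m)%N) : sgraph :=
  SGraph (@petersen_adj_sym m j) (petersen_adj_irrefl hj hjm).

(* Main.v *)
(** Reducing a labeling [f] modulo [n] and adding [n] times a proper labeling
    [l0] gives a proper labeling with the same sums modulo [n], taking at most
    (order of [f]) * (order of [l0]) values.  It therefore suffices to find open
    colorings, proper or not, of small order.  As the graph is cubic, a constant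
    [c] with [3 * c = k] modulo [n] works when [(3, n)] divides [k].  When [3]
    divides [m] but not [j], every open neighborhood of [v_i] or [u_i] meets
    each residue class of indices modulo [3] exactly once, so labeling the
    vertices of index divisible by [3] with [k] and the others with [0] works.
    Conversely, summing the open coloring condition over all [2m] vertices gives
    [3 * (sum of all labels) = 2mk] modulo [n], so [(3, n)] divides [km]. *)

Require Import Defs.
From mathcomp Require Import all_boot all_order all_algebra.
From mathcomp Require Import boolp zify ring.

Set Implicit Arguments.
Unset Strict Implicit.
Unset Printing Implicit Defensive.

Import Order.TTheory GRing.Theory Num.Theory.
Local Open Scope ring_scope.

Lemma chi_leq (G : sgraph) (l : G -> int) :
  proper_labeling l -> (chi G <= label_order l)%N.
Proof.
by move=> pl; rewrite /chi; case: ex_minnP => c _; apply; apply/asboolP; exists l.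
Qed.

Lemma chi_attained (G : sgraph) :
  exists2 l : G -> int, proper_labeling l & label_order l = chi G.
Proof. by rewrite /chi; case: ex_minnP => c /asboolP. Qed.

Lemma chi_open_Some (n : nat) (k : int) (G : sgraph) (l : G -> int) :
  proper_labeling l -> open_coloring n k l ->
  exists c, chi_open n k G = Some c /\ (chi G <= c <= label_order l)%N.
Proof.
move=> pl ol; rewrite /chi_open; case: pselect => [h|]; last first.
  by case; exists (label_order l); apply/asboolP; exists l.
exists (ex_minn h); split=> //; case: ex_minnP => c /asboolP[l' [pl' _] <-] min.
by rewrite chi_leq //=; apply: min; apply/asboolP; exists l.
Qed.

Lemma chi_open_None (n : nat) (k : int) (G : sgraph) :
  (forall l : G -> int, ~ open_coloring n k l) -> chi_open n k G = None.
Proof.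
move=> no; rewrite /chi_open; case: pselect => // -[c h]; exfalso.
by case/asboolP: h => l [_ ol]; case: (no l ol).
Qed.

Lemma modz_sum (n : int) (I : finType) (P : pred I) (f g : I -> int) :
  (forall i, f i = g i %[mod n])%Z ->
  (\sum_(i | P i) f i = \sum_(i | P i) g i %[mod n])%Z.
Proof.
move=> fg; apply: (big_rec2 (fun x y => x = y %[mod n])%Z) => // i x y _ xy.
by rewrite -modzDm fg xy modzDm.
Qed.

Lemma proper_open_coloring (n : nat) (k : int) (G : sgraph) (f l0 : G -> int) :
    (0 < n)%N -> open_coloring n k f -> proper_labeling l0 ->
  exists l : G -> int, [/\ proper_labeling l, open_coloring n k l &
    (label_order l <= label_order f * label_order l0)%N].
Proof.
(* The quotient of [comb a b] by [n] is [b], which preserves properness; its residue is that of [a],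
   which preserves the sums modulo [n]. *)
move=> n0 of_ pl0; pose comb (a b : int) : int := b * n%:Z + (a %% n%:Z)%Z.
have combK a b : (comb a b %/ n%:Z)%Z = b.
  by rewrite /comb divzMDl ?eqz_nat -?lt0n // divz_small ?addr0 //; lia.
exists (fun x => comb (f x) (l0 x)); split.
- move=> x y xy e; apply: (pl0 x y xy).
  by rewrite -[l0 x](combK (f x)) e combK.
- move=> v; rewrite -(of_ v); apply: modz_sum => w.
  by rewrite /comb modzMDl modz_mod.
rewrite /label_order -(size_allpairs comb).
apply: uniq_leq_size (undup_uniq _) _ => z.
rewrite mem_undup => /codomP[x ->].
by apply: (allpairs_f comb); rewrite mem_undup codom_f.
Qed.

Lemma label_order_le (G : sgraph) (l : G -> int) (s : seq int) :
  (forall x, l x \in s) -> (label_order l <= size s)%N.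
Proof.
move=> ls; apply: uniq_leq_size (undup_uniq _) _ => z.
by rewrite mem_undup => /codomP[x ->].
Qed.

Section Petersen.

Variables (m j : nat) (hj : (0 < j)%N) (hjm : (j.*2 < m)%N).

Let m_gt0 : (0 < m)%N. Proof. by lia. Qed.

Definition shift (s : nat) (i : 'I_m) : 'I_m :=
  Ordinal (ltn_pmod (i + s) m_gt0).

(** The neighbors of [a] are [a + s] and [a - s], distinct because [0 < 2s < m]. The backward shift
    is written [m - s] to stay in the naturals. The outer rim is the case [s = 1], the inner rim
    [s = j]. *)
Lemma sum_circulant (s : nat) (a : 'I_m) (F : 'I_m -> int) :
    (0 < s)%N -> (s.*2 < m)%N ->
  \sum_(b : 'I_m | (b == (a + s) %% m :> nat)%N
                    || (a == (b + s) %% m :> nat)%N) F b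
    = F (shift s a) + F (shift (m - s) a).
Proof.
move=> s0 sm; have am := ltn_ord a.
(* All indices to be reduced are below [2m], so each reduction is a case split that [lia] can
   finish. *)
have modlt x : (x < m.*2 -> x %% m = if x < m then x else x - m)%N.
  move=> xm2; case: (ltnP x m) => [|mx]; first exact: modn_small.
  by rewrite -{1}(subnK mx) modnDr modn_small //; lia.
have neq : shift (m - s) a != shift s a.
  by rewrite -val_eqE /= !modlt; repeat (case: ifP => ?); lia.
rewrite (bigD1 (shift s a)) /=; last by rewrite eqxx.
rewrite (bigD1 (shift (m - s) a)) /=; last first.
  rewrite neq andbT; apply/orP; right.
  by rewrite modnDml -addnA subnK ?modnDr ?modn_small //; lia.
rewrite big_pred0 ?addr0 // => b; have bm := ltn_ord b.
by rewrite -!val_eqE /= !modlt; repeat (case: ifP => ?); lia.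
Qed.

Hypothesis hm : (3 <= m)%N.

Local Notation G := (petersen hj hjm).

Lemma sum_nbhd_inl (F : 'I_m + 'I_m -> int) (i : 'I_m) :
  \sum_(w in nbhd (inl i : G)) F w =
    F (inl (shift 1 i)) + F (inl (shift (m - 1) i)) + F (inr i).
Proof.
under eq_bigl do rewrite inE.
rewrite big_sumType /= /petersen_adj /=; congr (_ + _).
  by rewrite (sum_circulant i (fun b => F (inl b))).
by under eq_bigl do rewrite orbF eq_sym; rewrite big_pred1_eq.
Qed.

Lemma sum_nbhd_inr (F : 'I_m + 'I_m -> int) (i : 'I_m) :
  \sum_(w in nbhd (inr i : G)) F w =
    F (inr (shift j i)) + F (inr (shift (m - j) i)) + F (inl i).
Proof.
under eq_bigl do rewrite inE.
rewrite big_sumType /= /petersen_adj /= addrC; congr (_ + _).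
  by rewrite (sum_circulant i (fun b => F (inr b))).
by rewrite big_pred1_eq.
Qed.

Lemma sum_nbhd_const (c : int) (v : G) : \sum_(w in nbhd v) c = 3 * c.
Proof.
by case: v => i; rewrite (sum_nbhd_inl (fun=> c), sum_nbhd_inr (fun=> c)); ring.
Qed.

(** Double counting: by symmetry of adjacency, each [l w] is counted once per neighbor of [w], hence
    three times. *)
Lemma sum_sum_nbhd (l : G -> int) :
  \sum_(v : G) \sum_(w in nbhd v) l w = 3 * \sum_(w : G) l w.
Proof.
rewrite (exchange_big_dep predT) //= mulr_sumr; apply: eq_bigr => w _.
rewrite -(sum_nbhd_const _ w); apply: eq_bigl => v.
by rewrite !inE adj_sym.
Qed.

Lemma open_coloring_dvd (n : nat) (k : int) (l : G -> int) :
  open_coloring n k l -> (gcdz 3 n%:Z %| k * m%:Z)%Z.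
Proof.
move=> ol; set d := gcdz 3 _.
have d3 : (d %| 3)%Z := dvdz_gcdl _ _.
have dn : (d %| n%:Z)%Z := dvdz_gcdr _ _.
have : (\sum_(v : G) \sum_(w in nbhd v) l w = \sum_(v : G) k %[mod n%:Z])%Z.
  exact: modz_sum.
rewrite sum_sum_nbhd sumr_const card_sum card_ord => /eqP.
rewrite eqz_mod_dvd => /(dvdz_trans dn); rewrite -[k *+ _]mulr_natr => dS.
(* With [S] the sum of all labels, [d] divides [3S - 2km]; as [km = 3km - 2km], adding the multiple
   [3(km - S)] of [d] leaves [km]. *)
have -> : k * m%:Z = 3 * (k * m%:Z - \sum_w l w)
    + (3 * \sum_w l w - k * (m + m)%:R).
  by rewrite natrD -[m%:Z]natz; ring.
exact: rpredD (dvdz_mulr _ d3) dS.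
Qed.

Lemma open_coloring_const (n : nat) (k : int) :
  (gcdz 3 n%:Z %| k)%Z -> exists c : int, open_coloring n k (fun _ : G => c).
Proof.
case/dvdzP=> q kE; have [u [v uv]] := Bezoutz 3 n%:Z.
(* From [3u + nv = (3, n)] and [k = q(3, n)], one gets [3qu = k - qvn]. *)
exists (q * u) => x; rewrite sum_nbhd_const; apply/eqP; rewrite eqz_mod_dvd.
by apply/dvdzP; exists (- (q * v)); rewrite kE -uv; ring.
Qed.

Definition index_coloring (k : int) (x : 'I_m + 'I_m) : int :=
  let i := match x with inl i | inr i => i end in
  if (3 %| i)%N then k else 0.

Lemma open_coloring_index (n : nat) (k : int) :
  (3 %| m)%N -> ~~ (3 %| j)%N -> open_coloring n k (index_coloring k : G -> int).
Proof.
move=> m3 j3.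
(* Since 3 does not divide [s], the indices [i + s], [i - s] and [i] cover all residues modulo 3;
   reduction modulo [m] keeps these residues because 3 divides [m]. The third index [i] is that of
   the spoke. *)
have once (s : nat) (i : 'I_m) : (s < m)%N -> ~~ (3 %| s)%N ->
    (if (3 %| (i + s) %% m)%N then k else 0)
    + (if (3 %| (i + (m - s)) %% m)%N then k else 0)
    + (if (3 %| i)%N then k else 0) = k.
  move=> sm s3; rewrite /dvdn !(modn_dvdm _ m3) -!/(dvdn _ _).
  case: ifPn => a; case: ifPn => b; case: ifPn => c; rewrite ?addr0 ?add0r //; lia.
case=> i; congr (_ %% _)%Z.
- by rewrite (sum_nbhd_inl (index_coloring k)) /index_coloring /= once //; lia.
- by rewrite (sum_nbhd_inr (index_coloring k)) /index_coloring /= once //; lia.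
Qed.

End Petersen.

Lemma gcdz3 (n : nat) : gcdz 3 n%:Z = 1 \/ gcdz 3 n%:Z = 3.
Proof.
have /(_ _ (dvdn_gcdl 3 n)) := proj2 (primeP (isT : prime 3)).
by rewrite /gcdz /= => /pred2P[] ->; [left | right].
Qed.

Theorem theorem6p13 (k : int) (n m j : nat)
    (hn : (2 <= n)%N) (hk : (k <> 0 %[mod n%:Z])%Z)
    (hm : (3 <= m)%N) (hj : (0 < j)%N) (hjm : (j.*2 < m)%N) :
  let G := petersen hj hjm in
  let d : int := gcdz 3 n%:Z in
  [/\ (d %| k)%Z -> chi_open n k G = Some (chi G),
      ~~ (d %| k * m%:Z)%Z -> chi_open n k G = None
    & ~~ (d %| k)%Z -> (d %| k * m%:Z)%Z -> ~~ (3 %| j)%N ->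
      exists c : nat, chi_open n k G = Some c /\ (chi G <= c <= 2 * chi G)%N].
Proof.
move=> G d; have [l0 pl0 ol0] := chi_attained G.
(* An open coloring with values in [s] costs at most a factor [size s] over [chi G]: one value
   settles the first claim, two values the third. *)
have bound (f : G -> int) (s : seq int) :
    open_coloring n k f -> (forall x, f x \in s) ->
    exists c, chi_open n k G = Some c /\ (chi G <= c <= size s * chi G)%N.
  move=> of_ fs; have n0 : (0 < n)%N by lia.
  have [l [pl ol le_l]] := proper_open_coloring n0 of_ pl0.
  have [c [-> /andP[ge_c le_c]]] := chi_open_Some pl ol.
  exists c; split=> //; rewrite ge_c (leq_trans le_c) // (leq_trans le_l) //.
  by rewrite ol0 leq_mul2r label_order_le ?orbT.
split.
- move=> dk; have [c oc] := open_coloring_const hj hjm hm dk.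
  have [e [-> ]] := bound _ [:: c] oc (fun=> mem_head _ _).
  by rewrite mul1n -eqn_leq => /eqP ->.
- move=> ndkm; apply: chi_open_None => l /(open_coloring_dvd hm).
  exact/negP.
(* Here [d] is not 1, so it is the prime 3, and Euclid's lemma moves the divisibility from [km] to
   [m]. *)
move=> ndk dkm j3; have d3 : d = 3.
  by case: (gcdz3 n) => // d1; rewrite /d d1 dvd1z in ndk.
rewrite d3 in ndk dkm; have m3 : (3 %| m)%N.
  by move: dkm; rewrite dvdzE abszM Euclid_dvdM // -!dvdzE (negPf ndk).
have oi : open_coloring n k (index_coloring k : G -> int).
  exact: open_coloring_index.
apply: (bound _ [:: k; 0] oi).
by move=> x; rewrite /index_coloring !inE; case: ifP; rewrite eqxx ?orbT.
Qed.
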